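(* Let each $f_i:\mathbb{R}^m\to\mathbb{R}$ ($i\in[n]$) be coercive and $r+1$ times continuously differentiable for some $r\ge 1$, with $\nabla f_i$ being $L_i$-Lipschitz continuous, and twice differentiable with $\nabla^2 f_i$ being $L_{\nabla^2_i}$-Lipschitz continuous; set $L_{\nabla^2}=\sum_{i=1}^nL_{\nabla_i^2}$ and $L_{\nabla_c^2}=\max_iL_{\nabla_i^2}$. Suppose there exist $0<\epsilon_0<R$ and $\delta_0>0$ such that $\inf_{\boldsymbol\theta\in\mathcal S_{R,\epsilon_0}}\langle\nabla f_i(\boldsymbol\theta),\boldsymbol\theta/\|\boldsymbol\theta\|\rangle\ge\delta_0$ for all $i\in[n]$. Let the undirected graph $\mathcal G$ be connected, let $\mathcal X_i\subseteq\mathcal B^m_R$, $i\in[n]$, be compact sets with positive Lebesgue measure, let $0<\alpha\le\alpha_{\max}\triangleq\sigma_{\min}(\mathbf I+\mathbf D)/L_c$, let $\mathbf{x}_i^0\in\mathcal X_i$ for all $i$, and let $\{\mathbf{x}^\nu\}$ be generated by DGD with step-size $\alpha$ and initialization $\mathbf{x}^0$. Let $\mathcal Y$ be a compact set containing all DGD sequences with step-size in $(0,\alpha_{\max}]$ and initialization in $\prod_i\mathcal X_i$, and let $\bar{\mathcal Y}$ be the image of $\mathcal Y$ under the linear operator $(\mathbf 1_n\otimes\mathbf I_m)^\top$. Suppose that the limit point $\mathbf{x}^\infty=[\mathbf{x}_1^{\infty\top},\ldots,\mathbf{x}_n^{\infty\top}]^\top$ of $\{\mathbf{x}^\nu\}$,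 along with $\bar{\mathbf{x}}^\infty=\frac1n\sum_{i=1}^n\mathbf{x}_i^\infty$, satisfies (i) $\mathrm{dist}(\bar{\mathbf{x}}^\infty,\mathrm{crit}\,F)<\dfrac{\delta}{2L_{\nabla^2}}$, (ii) $\|\mathbf{x}^\infty-\mathbf 1\otimes\bar{\mathbf{x}}^\infty\|<\dfrac{\delta}{2nL_{\nabla^2_c}}$, (iii) there exists $\boldsymbol\theta^*\in\mathrm{proj}_{\mathrm{crit}\,F}(\bar{\mathbf{x}}^\infty)\cap\Theta^*_{ss}$, for some $\delta$ such that $\delta\le-\lambda_{\min}(\nabla^2F(\boldsymbol\theta^* ))$ for all $\boldsymbol\theta^*\in\Theta^*_{ss}\cap\bar{\mathcal Y}$. Then $\mathbf{x}^\infty$ is a strict saddle point of $L_\alpha$.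
   Context: Problem: $F(\boldsymbol\theta)=\sum_{i=1}^n f_i(\boldsymbol\theta)$, $\boldsymbol\theta\in\mathbb{R}^m$; $\mathrm{crit}\,F=\{\boldsymbol\theta:\nabla F(\boldsymbol\theta)=\mathbf 0\}$. A strict saddle of a twice differentiable function is a critical point at which the Hessian has at least one negative eigenvalue; $\Theta_{ss}^*$ is the set of strict saddles of $F$. $\mathrm{proj}_{\mathcal X}(\mathbf z)=\arg\min_{\mathbf w\in\mathcal X}\|\mathbf z-\mathbf w\|$ (set-valued). A function is coercive if it tends to $+\infty$ as its argument tends to infinity in norm. $\mathcal B^m_R$ is the closed ball in $\mathbb{R}^m$ of radius $R$ centered at $\mathbf 0$, and $\mathcal S_{R,\epsilon_0}=\mathcal B^m_R\setminus\mathcal B^m_{R-\epsilon_0}$. For $\mathbf{x}=[\mathbf{x}_1^\top,\ldots,\mathbf{x}_n^\top]^\top\in\mathbb{R}^{mn}$, $F_c(\mathbf{x})=\sum_i f_i(\mathbf{x}_i)$, $L_c=\max_iL_i$, and $L_\alpha(\mathbf{x})=F_c(\mathbf{x})+\frac1{2\alpha}\mathbf{x}^\top(\mathbf I-\mathbf W_D)\mathbf{x}$ with $\mathbf W_D=\mathbf D\otimes\mathbf I_m$. Network: $\mathcal G=([n],\mathcal E)$ is an undirected graph. Weight matrix: $\mathbf D\in\mathbb{R}^{n\times n}$ is nonnegative, symmetric, doubly stochastic and compliant to $\mathcal G$: $D_{ii}>0$ for all $i$ and, for $i\ne j$, $D_{ij}>0$ if and only if $(j,i)\in\mathcal E$,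 $D_{ij}=0$ otherwise. DGD with step-size $\alpha$ and initialization $\mathbf{x}^0\in\mathbb{R}^{mn}$: $\mathbf{x}^{\nu+1}=\mathbf{W}_D\mathbf{x}^\nu-\alpha\nabla F_c(\mathbf{x}^\nu)$ (equivalently $\mathbf{x}^{\nu+1}=\mathbf{x}^\nu-\alpha\nabla L_\alpha(\mathbf{x}^\nu)$). $\sigma_{\min}$, $\lambda_{\min}$ denote smallest singular value and smallest eigenvalue.
   Formalization: The strict saddle θ* in (iii) is also required to satisfy δ ≤ −λ_min(∇²F(θ* )), automatic when θ* lies in Ȳ; otherwise δ could be unbounded and the claim false. ''The limit point'' is read as the limit of the DGD sequence. *)

(* Defs.v *)
From HB Require Import structures.
From mathcomp Require Import all_boot all_order all_algebra.
From mathcomp Require Import all_classical all_reals all_analysis.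
From mathcomp Require Import mxtens.

Set Implicit Arguments.
Unset Strict Implicit.
Unset Printing Implicit Defensive.

Import Order.TTheory GRing.Theory Num.Theory.
Import numFieldNormedType.Exports.

Local Open Scope classical_set_scope.
Local Open Scope ring_scope.

(** Euclidean geometry of R^d, with vectors as columns. The library norm `|x|
    on matrices is the sup norm, so the Euclidean one is defined here; the two
    induce the same topology, and the library's [compact], [continuous],
    [differentiable] and convergence are used as they are. *)

Definition dotv (R : realType) d (x y : 'cV[R]_d) : R :=
  \sum_(j < d) x j 0 * y j 0.

Definition enorm (R : realType) d (x : 'cV[R]_d) : R := Num.sqrt (dotv x x).

Definition eball (R : realType) d (r : R) : set 'cV[R]_d :=
  [set x | enorm x <= r].

Definition shell (R : realType) d (r e : R) : set 'cV[R]_d :=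
  @eball R d r `\` @eball R d (r - e).

Definition dist (R : realType) d (x : 'cV[R]_d) (A : set 'cV[R]_d) : R :=
  inf [set enorm (x - y) | y in A].

Definition proj_set (R : realType) d (A : set 'cV[R]_d) (z : 'cV[R]_d) :
    set 'cV[R]_d :=
  [set w | A w /\ forall w', A w' -> enorm (z - w) <= enorm (z - w')].

Definition coercive (R : realType) d (f : 'cV[R]_d -> R) : Prop :=
  forall M : R, exists r : R, forall x, r <= enorm x -> M <= f x.

(** Lebesgue outer measure on R^d, by countable covers by closed boxes. It is
    only applied to compact sets, on which it is the Lebesgue measure. *)

Definition box (R : realType) d (a b : 'cV[R]_d) : set 'cV[R]_d :=
  [set x | forall j, a j 0 <= x j 0 <= b j 0].

Definition lebesgue_outer (R : realType) d (A : set 'cV[R]_d) : \bar R :=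
  ereal_inf [set s : \bar R | exists a b : nat -> 'cV[R]_d,
    [/\ forall k j, a k j 0 <= b k j 0,
        A `<=` \bigcup_k box (a k) (b k) &
        s = (\sum_(0 <= k <oo) (\prod_(j < d) (b k j 0 - a k j 0))%:E)%E]].

(** Smallest eigenvalue and smallest singular value; [lambda_min] is only
    applied to symmetric matrices, whose real spectrum is finite and, for
    d > 0, nonempty, so that the infimum is a minimum. *)

Definition lambda_min (R : realType) d (A : 'M[R]_d) : R :=
  inf [set l | eigenvalue A l].

Definition sigma_min (R : realType) d (A : 'M[R]_d) : R :=
  Num.sqrt (lambda_min (A^T *m A)).

Definition spectral_norm (R : realType) d (A : 'M[R]_d) : R :=
  sup [set enorm (A *m v) | v in @eball R d 1].

Definition partial (R : realType) d (j : 'I_d) (f : 'cV[R]_d -> R) :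
    'cV[R]_d -> R :=
  fun x => 'D_(delta_mx j 0) f x.

Definition grad (R : realType) d (f : 'cV[R]_d -> R) (x : 'cV[R]_d) :
    'cV[R]_d :=
  \col_j partial j f x.

Definition hess (R : realType) d (f : 'cV[R]_d -> R) (x : 'cV[R]_d) :
    'M[R]_d :=
  \matrix_(i, j) partial j (partial i f) x.

Fixpoint cont_diff (R : realType) d (k : nat) (f : 'cV[R]_d -> R) : Prop :=
  if k is k'.+1 then
    (forall x, differentiable f x) /\
    (forall j, cont_diff k' (partial j f))
  else continuous f.

Definition grad_lipschitz (R : realType) d (L : R) (f : 'cV[R]_d -> R) :=
  forall x y, enorm (grad f x - grad f y) <= L * enorm (x - y).

Definition hess_lipschitz (R : realType) d (L : R) (f : 'cV[R]_d -> R) :=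
  forall x y, spectral_norm (hess f x - hess f y) <= L * enorm (x - y).

Definition crit (R : realType) d (f : 'cV[R]_d -> R) : set 'cV[R]_d :=
  [set x | grad f x = 0].

Definition strict_saddle (R : realType) d (f : 'cV[R]_d -> R) :
    set 'cV[R]_d :=
  [set x | crit f x /\ exists2 l, eigenvalue (hess f x) l & l < 0].

(** Network: [e] is the edge relation of an undirected graph on [n] nodes. *)

Definition connected_graph n (e : rel 'I_n) : Prop :=
  symmetric e /\ forall i j, connect e i j.

Definition weight_matrix (R : realType) n (e : rel 'I_n) (D : 'M[R]_n) : Prop :=
  [/\ forall i j, 0 <= D i j,
      D^T = D,
      (forall i, \sum_j D i j = 1) /\ (forall j, \sum_i D i j = 1),
      forall i, 0 < D i i &
      forall i j, i != j -> (0 < D i j <-> e j i) /\ (~~ e j i -> D i j = 0)].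

(** Stacked vectors of R^(mn): [tensmx] (written *t) is the Kronecker product,
    and [mxtens_index (i, j)] is the position of entry j of block i. *)

Definition blk (R : realType) n m (i : 'I_n) (x : 'cV[R]_(n * m)) : 'cV[R]_m :=
  \col_j x (mxtens_index (i, j)) 0.

Definition WD (R : realType) n m (D : 'M[R]_n) : 'M[R]_(n * m) :=
  D *t (1%:M : 'M[R]_m).

Definition ones (R : realType) n : 'cV[R]_n := const_mx 1.

(** 1_n (x) I_m; the cast only identifies 1 * m with m. *)
Definition ones_kron (R : realType) n m : 'M[R]_(n * m, m) :=
  castmx (erefl, mul1n m) (ones R n *t (1%:M : 'M[R]_m)).

Definition bmean (R : realType) n m (x : 'cV[R]_(n * m)) : 'cV[R]_m :=
  n%:R^-1 *: \sum_(i < n) blk i x.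

Definition Fsum (R : realType) n m (f : 'I_n -> 'cV[R]_m -> R)
    (theta : 'cV[R]_m) : R :=
  \sum_(i < n) f i theta.

Definition Fc (R : realType) n m (f : 'I_n -> 'cV[R]_m -> R)
    (x : 'cV[R]_(n * m)) : R :=
  \sum_(i < n) f i (blk i x).

Definition Lalpha (R : realType) n m (D : 'M[R]_n)
    (f : 'I_n -> 'cV[R]_m -> R) (alpha : R) (x : 'cV[R]_(n * m)) : R :=
  Fc f x + (2 * alpha)^-1 * (x^T *m (1%:M - WD m D) *m x) 0 0.

Definition DGD (R : realType) n m (D : 'M[R]_n)
    (f : 'I_n -> 'cV[R]_m -> R) (alpha : R) (x : nat -> 'cV[R]_(n * m)) : Prop :=
  forall nu, x nu.+1 = WD m D *m x nu - alpha *: grad (Fc f) (x nu).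

(** The maximum, for a nonnegative family such as one of Lipschitz constants. *)
Definition vmax (R : realType) n (L : 'I_n -> R) : R :=
  \big[Num.max/0]_(i < n) L i.

Definition alpha_max (R : realType) n (D : 'M[R]_n) (L : 'I_n -> R) : R :=
  sigma_min (1%:M + D) / vmax L.

(* Main.v *)
Require Import Defs.
From HB Require Import structures.
From mathcomp Require Import all_boot all_order all_algebra.
From mathcomp Require Import all_classical all_reals all_analysis.
From mathcomp Require Import mxtens.
From mathcomp Require Import ring lra.

(** Critical point. The limit of the iteration is a fixed point of it, hence a
    critical point of L_alpha, by continuity of the gradients
    ([DGD_limit_crit]).

    Negative curvature. The Hessian of L_alpha at x is the block diagonal matrix
    of the Hessians of the f_i at the blocks of x, plus alpha^-1 (I - W_D). In a
    consensual direction 1 (x) u the second part vanishes, because D is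
    stochastic, so the quadratic form there is the sum of the <u, H_i(x_i) u>
    ([quad_form_hess_Lalpha]). If all blocks were equal to the strict saddle
    theta of F, this sum would be <u, H_F(theta) u>, and an eigenvector u of the
    smallest eigenvalue would make it at most -delta |u|^2. Moving from theta to
    the mean of the blocks, and from the mean to the blocks themselves, changes
    the sum by less than delta/2 |u|^2 each time, by the Lipschitz bounds on the
    Hessians and the bounds on the two distances. Hence the form is negative in
    some consensual direction ([consensus_negative_curvature]).

    Eigenvalue. A direction of negative curvature yields a negative eigenvalue
    only because the Hessian is symmetric. Symmetry is Schwarz's theorem on mixed
    derivatives ([mixed_derivatives_eq]); the passage from the form to the
    eigenvalue is the variational characterization of the smallest eigenvalue
    ([neg_quad_form_eigenvalue]). *)

Set Implicit Arguments.
Unset Strict Implicit.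
Unset Printing Implicit Defensive.

Import Order.TTheory GRing.Theory Num.Theory.
Import numFieldNormedType.Exports.

Local Open Scope classical_set_scope.
Local Open Scope ring_scope.

(** * Quadratic forms and the smallest eigenvalue *)

Lemma dotvE (R : realType) d (x y : 'cV[R]_d) : dotv x y = (x^T *m y) 0 0.
Proof. by rewrite mxE; apply: eq_bigr => j _; rewrite mxE. Qed.

Lemma dotvC (R : realType) d (x y : 'cV[R]_d) : dotv x y = dotv y x.
Proof. by apply: eq_bigr => j _; rewrite mulrC. Qed.

Lemma dotvDr (R : realType) d (x y z : 'cV[R]_d) :
  dotv x (y + z) = dotv x y + dotv x z.
Proof. by rewrite !dotvE mulmxDr mxE. Qed.

Lemma dotvZr (R : realType) d (a : R) (x y : 'cV[R]_d) :
  dotv x (a *: y) = a * dotv x y.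
Proof. by rewrite !dotvE -scalemxAr mxE. Qed.

Lemma dotvDl (R : realType) d (x y z : 'cV[R]_d) :
  dotv (x + y) z = dotv x z + dotv y z.
Proof. by rewrite dotvC dotvDr !(dotvC z). Qed.

Lemma dotvZl (R : realType) d (a : R) (x y : 'cV[R]_d) :
  dotv (a *: x) y = a * dotv x y.
Proof. by rewrite dotvC dotvZr dotvC. Qed.

Lemma dotv_sumr (R : realType) d n (x : 'cV[R]_d) (y : 'I_n -> 'cV[R]_d) :
  dotv x (\sum_i y i) = \sum_i dotv x (y i).
Proof.
by rewrite dotvE mulmx_sumr summxE; apply: eq_bigr => i _; rewrite dotvE.
Qed.

Lemma dotv_adj (R : realType) d (A : 'M[R]_d) (x y : 'cV[R]_d) :
  dotv x (A *m y) = dotv (A^T *m x) y.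
Proof. by rewrite !dotvE trmx_mul trmxK mulmxA. Qed.

Lemma dotv_ge0 (R : realType) d (x : 'cV[R]_d) : 0 <= dotv x x.
Proof. by apply: sumr_ge0 => j _; rewrite -expr2 sqr_ge0. Qed.

Lemma dotv_eq0 (R : realType) d (x : 'cV[R]_d) : (dotv x x == 0) = (x == 0).
Proof.
apply/eqP/eqP => [|->]; last by rewrite /dotv big1 // => j _; rewrite mxE mul0r.
move/eqP; rewrite psumr_eq0 => [/allP x0|j _]; last by rewrite -expr2 sqr_ge0.
apply/colP => j; rewrite mxE; apply/eqP.
by have := x0 j; rewrite mem_index_enum mulf_eq0 orbb => /(_ isT).
Qed.

Lemma sqr_le_dotv (R : realType) d (x : 'cV[R]_d) j : x j 0 ^+ 2 <= dotv x x.
Proof.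
rewrite /dotv (bigD1 j) //= expr2 lerDl.
by apply: sumr_ge0 => k _; rewrite -expr2 sqr_ge0.
Qed.

(** A crude finite bound is enough: it makes the Rayleigh quotients of a matrix
    bounded, so that the infimum of the quotients and the spectral norm exist.
    It rests on |x_i x_j| <= |x|^2. *)
Lemma quad_form_le (R : realType) d (A : 'M[R]_d) (x : 'cV[R]_d) :
  dotv x (A *m x) <= (\sum_i \sum_j `|A i j|) * dotv x x.
Proof.
rewrite {1}/dotv mulr_suml; apply: ler_sum => i _.
rewrite mxE mulr_sumr mulr_suml; apply: ler_sum => j _.
have xx : `|x i 0 * x j 0| <= dotv x x.
  have := sqr_le_dotv x i; have := sqr_le_dotv x j.
  rewrite -(real_normK (num_real (x i 0))) -(real_normK (num_real (x j 0))).
  by rewrite normrM; nra.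
apply: le_trans (ler_wpM2l (normr_ge0 (A i j)) xx).
by rewrite -normrM mulrCA ler_norm.
Qed.

(** The usual discriminant argument: the form is nonnegative along every
    combination of x and y. *)
Lemma psd_cauchy_schwarz (R : realType) d (B : 'M[R]_d) (x y : 'cV[R]_d) :
  B^T = B -> (forall z, 0 <= dotv z (B *m z)) ->
  dotv x (B *m y) ^+ 2 <= dotv x (B *m x) * dotv y (B *m y).
Proof.
move=> Bsym Bpos.
set a := dotv x (B *m x); set b := dotv x (B *m y); set c := dotv y (B *m y).
have quad (s t : R) : 0 <= s ^+ 2 * a + 2 * s * t * b + t ^+ 2 * c.
  have := Bpos (s *: x + t *: y); congr (_ <= _).
  rewrite mulmxDr -!scalemxAr !(dotvDl, dotvDr, dotvZl, dotvZr) -/a -/b -/c.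
  have -> : dotv y (B *m x) = b by rewrite /b dotv_adj Bsym dotvC.
  by ring.
have a_ge0 : 0 <= a := Bpos x; have c_ge0 : 0 <= c := Bpos y.
have [c0|c_neq0] := eqVneq c 0.
  have [->|b0] := eqVneq b 0; first by rewrite expr0n mulr_ge0.
  (* On an isotropic y the form is affine along y; this step makes it -1. *)
  have := quad 1 (- (a + 1) / (2 * b)); rewrite c0 mulr0 addr0 !mulr1 expr1n mul1r.
  suff -> : a + 2 * (- (a + 1) / (2 * b)) * b = - 1 by lra.
  by field.
have c_gt0 : 0 < c by rewrite lt_def c_neq0.
rewrite -(ler_pM2l c_gt0) -subr_ge0; apply: le_trans (quad c (- b)) _.
by rewrite le_eqVlt; apply/orP; left; apply/eqP; ring.
Qed.

Lemma dotv_cauchy_schwarz (R : realType) d (x y : 'cV[R]_d) :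
  dotv x y <= enorm x * enorm y.
Proof.
rewrite /enorm -sqrtrM ?dotv_ge0 //; apply: le_trans (ler_norm _) _.
rewrite -sqrtr_sqr ler_wsqrtr //.
have := @psd_cauchy_schwarz _ _ 1%:M x y (trmx1 _ _).
by rewrite !mul1mx; apply=> z; rewrite mul1mx dotv_ge0.
Qed.

(** The eigenvalue is the infimum t0 of the Rayleigh quotients, obtained as the
    largest t such that A - t I is positive semidefinite; t0 is negative because
    the quotient at u is. Were B := A - t0 I invertible, the Cauchy-Schwarz
    inequality of the semidefinite form B, applied to x and B^-1 x, would give
      |x|^4 <= <x, B x> <x, B^-1 x> <= c <x, B x> |x|^2,
    so that A - (t0 + 1/c) I would still be semidefinite, against the choice of
    t0. This replaces the compactness of the unit sphere. *)
Lemma neg_quad_form_eigenvalue (R : realType) d (A : 'M[R]_d) (u : 'cV[R]_d) :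
  A^T = A -> dotv u (A *m u) < 0 -> exists2 l, eigenvalue A l & l < 0.
Proof.
move=> Asym uneg.
have uu_gt0 : 0 < dotv u u.
  rewrite lt_def dotv_ge0 andbT dotv_eq0; apply/eqP => u0.
  by move: uneg; rewrite u0 mulmx0 dotvE mulmx0 mxE ltxx.
pose S := [set t | forall x, t * dotv x x <= dotv x (A *m x)].
have S_lb : S (- \sum_i \sum_j `|(- A) i j|).
  move=> x; have := quad_form_le (- A) x.
  by rewrite mulNmx dotvE mulmxN mxE -dotvE; lra.
have S_ub : ubound S (dotv u (A *m u) / dotv u u).
  by move=> t /(_ u); rewrite ler_pdivlMr.
have supS : has_sup S.
  split; first by exists (- \sum_i \sum_j `|(- A) i j|).
  by exists (dotv u (A *m u) / dotv u u).
pose t0 := sup S.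
have St0 : S t0.
  move=> x; have [->|x0] := eqVneq x 0.
    by rewrite mulmx0 dotvE mulmx0 mxE mulr0.
  have xx_gt0 : 0 < dotv x x by rewrite lt_def dotv_ge0 dotv_eq0 x0.
  rewrite -ler_pdivlMr //; apply: ge_sup; first by case: supS.
  by move=> t /(_ x); rewrite ler_pdivlMr.
exists t0; last first.
  apply: (@le_lt_trans _ _ (dotv u (A *m u) / dotv u u)).
    by apply: ge_sup => //; case: supS.
  by rewrite pmulr_llt0 // invr_gt0.
pose B := A - t0%:M.
have BE x : dotv x (B *m x) = dotv x (A *m x) - t0 * dotv x x.
  by rewrite mulmxBl mul_scalar_mx -scaleNr dotvDr dotvZr mulNr.
rewrite /eigenvalue /eigenspace -/B kermx_eq0 row_free_unit; apply/negP => Bunit.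
have Bsym : B^T = B by rewrite /B linearB /= Asym tr_scalar_mx.
have Bpos z : 0 <= dotv z (B *m z) by rewrite BE subr_ge0; apply: St0.
(* The summand 1 only makes c positive. *)
pose c := 1 + \sum_i \sum_j `|invmx B i j|.
have c_gt0 : 0 < c by rewrite ltr_pwDl // sumr_ge0 // => i _; rewrite sumr_ge0.
have coer x : dotv x x <= c * dotv x (B *m x).
  have [->|x0] := eqVneq x 0.
    by rewrite mulmx0 dotvE mulmx0 mxE mulr0.
  have xx_gt0 : 0 < dotv x x by rewrite lt_def dotv_ge0 dotv_eq0 x0.
  have := psd_cauchy_schwarz x (invmx B *m x) Bsym Bpos.
  rewrite mulmxA mulmxV // mul1mx (dotvC (_ *m _)) => cs.
  have le : dotv x (invmx B *m x) <= c * dotv x x.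
    apply: le_trans (quad_form_le _ _) _.
    by rewrite /c mulrDl mul1r lerDr dotv_ge0.
  rewrite -(ler_pM2r xx_gt0) -expr2; apply: le_trans cs _.
  by rewrite mulrAC mulrC; apply: ler_wpM2r.
have : S (t0 + c^-1).
  move=> x; rewrite mulrDl addrC -lerBrDr -BE mulrC ler_pdivrMr // mulrC.
  exact: coer.
by move/(sup_upper_bound supS); rewrite -/t0 gerDl leNgt invr_gt0 c_gt0.
Qed.

Lemma enorm_mulmx_le_spectral_norm (R : realType) d (A : 'M[R]_d)
    (w : 'cV[R]_d) : enorm w <= 1 -> enorm (A *m w) <= spectral_norm A.
Proof.
move=> w1; apply: ub_le_sup; last by exists w.
exists (Num.sqrt (\sum_i \sum_j `|(A^T *m A) i j|)) => _ [v v1 <-].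
apply: ler_wsqrtr; rewrite dotv_adj mulmxA dotvC.
apply: le_trans (quad_form_le _ _) _.
rewrite ler_piMr ?sumr_ge0 // => [i _|]; first by rewrite sumr_ge0.
by rewrite -(@ler_sqrt _ _ 1) // sqrtr1.
Qed.

Lemma spectral_norm_ge0 (R : realType) d (A : 'M[R]_d) : 0 <= spectral_norm A.
Proof.
apply: le_trans (@enorm_mulmx_le_spectral_norm _ _ A 0 _); first exact: sqrtr_ge0.
by rewrite /enorm dotvE mulmx0 mxE sqrtr0.
Qed.

Lemma quad_form_le_spectral_norm (R : realType) d (A : 'M[R]_d) (u : 'cV[R]_d) :
  dotv u (A *m u) <= spectral_norm A * dotv u u.
Proof.
have [->|u0] := eqVneq u 0.
  by rewrite mulmx0 dotvE mulmx0 mxE mulr0.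
have uu_gt0 : 0 < dotv u u by rewrite lt_def dotv_ge0 dotv_eq0 u0.
set s := enorm u; have s_gt0 : 0 < s by rewrite sqrtr_gt0.
have ss : s ^+ 2 = dotv u u by rewrite sqr_sqrtr ?dotv_ge0.
have w1 : enorm (s^-1 *: u) = 1.
  rewrite /enorm dotvZl dotvZr -ss mulrA -expr2 exprVn mulVf ?sqrtr1 //.
  by rewrite expf_neq0 ?gt_eqF.
have sp : enorm (A *m (s^-1 *: u)) <= spectral_norm A.
  by apply: enorm_mulmx_le_spectral_norm; rewrite w1.
have := dotv_cauchy_schwarz (s^-1 *: u) (A *m (s^-1 *: u)).
rewrite w1 mul1r -scalemxAr dotvZl dotvZr mulrA -expr2 exprVn ss => le1.
rewrite -ler_pdivrMr // mulrC; apply: le_trans le1 _.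
by rewrite scalemxAr.
Qed.

(** * Symmetry of second derivatives *)

Lemma directional_mvt (R : realType) (V : normedModType R) (g : V -> R)
    (a v : V) (h : R) : 0 < h -> (forall y, derivable g y v) ->
  exists2 c, 0 <= c <= h & g (h *: v + a) - g a = h * 'D_v g (c *: v + a).
Proof.
move=> h_gt0 dg; pose phi (t : R) : R := g (t *: v + a).
have dphi (t : R) : is_derive t 1 phi ('D_v g (t *: v + a)).
  have quotE : (fun k => k^-1 *: ((phi \o shift t) (k *: 1) - phi t)) =
      (fun k => k^-1 *: ((g \o shift (t *: v + a)) (k *: v) - g (t *: v + a))).
    by apply/funext => k; rewrite /phi /= [_%:A]mulr1 scalerDl addrA.
  by split; [rewrite /derivable quotE; exact: dg | rewrite /derive quotE].
have [c c0h E] : exists2 c, c \in `[0, h]%R &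
    phi h - phi 0 = 'D_v g (c *: v + a) * (h - 0).
  apply: MVT_segment (ltW h_gt0) (fun t _ => dphi t) _.
  by apply: derivable_within_continuous => t _; have := dphi t; case.
exists c; first by rewrite in_itv in c0h.
by move: E; rewrite /phi scale0r add0r subr0 mulrC.
Qed.

Lemma is_derive_translate (R : realType) (V : normedModType R) (g : V -> R)
    (w y v : V) : derivable g (w + y) v ->
  is_derive y v (fun z => g (w + z)) ('D_v g (w + y)).
Proof.
have quotE : (fun k => k^-1 *: (((fun z => g (w + z)) \o shift y) (k *: v)
      - g (w + y))) =
    (fun k => k^-1 *: ((g \o shift (w + y)) (k *: v) - g (w + y))).
  by apply/funext => k /=; rewrite addrCA.
by move=> dg; split; rewrite /derivable /derive quotE.
Qed.

(** The mean value theorem is applied along u to the increment of f over h v,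
    and then along v to the derivative of f along u. The left-hand side is
    symmetric in u and v, from which the equality of the mixed derivatives
    follows. *)
Lemma second_difference (R : realType) (V : normedModType R) (f : V -> R)
    (a u v : V) (h : R) : 0 < h ->
  (forall y, derivable f y u) -> (forall y, derivable ('D_u f) y v) ->
  exists c1 c2, [/\ 0 <= c1 <= h, 0 <= c2 <= h &
    f (h *: v + (h *: u + a)) - f (h *: u + a) - (f (h *: v + a) - f a) =
    h * (h * 'D_v ('D_u f) (c2 *: v + (c1 *: u + a)))].
Proof.
move=> h_gt0 du dvu.
pose G y := f (h *: v + y) - f y.
have dG y : is_derive y u G ('D_u f (h *: v + y) - 'D_u f y).
  by apply: is_deriveB; [exact: is_derive_translate | exact: derivableP].
have [c1 c1h E1] : exists2 c, 0 <= c <= h &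
    G (h *: u + a) - G a = h * 'D_u G (c *: u + a).
  by apply: (directional_mvt a h_gt0) => y; have [] := dG y.
have [c2 c2h E2] := directional_mvt (c1 *: u + a) h_gt0 dvu.
exists c1, c2; split => //.
by rewrite -/(G (h *: u + a)) -/(G a) E1 (@derive_val _ _ _ _ _ _ _ (dG _)) E2.
Qed.

(** Both mixed derivatives take the same value, the second difference divided
    by h^2, at points of the parallelogram spanned by h u and h v at a. These
    points tend to a with h, and both derivatives are continuous there. *)
Lemma mixed_derivatives_eq (R : realType) (V : normedModType R) (f : V -> R)
    (a u v : V) :
  (forall y, derivable f y u) -> (forall y, derivable f y v) ->
  (forall y, derivable ('D_u f) y v) -> (forall y, derivable ('D_v f) y u) ->
  {for a, continuous ('D_v ('D_u f))} -> {for a, continuous ('D_u ('D_v f))} ->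
  'D_v ('D_u f) a = 'D_u ('D_v f) a.
Proof.
move=> du dv dvu duv cvu cuv; apply/eqP; rewrite -subr_eq0 -normr_eq0.
rewrite eq_le normr_ge0 andbT; apply/ler_addgt0Pl => e e_gt0; rewrite addr0.
have e2_gt0 : 0 < e / 2 by rewrite divr_gt0.
have /cvgrPdist_lt/(_ _ e2_gt0)/nbhs_normP[d1 /= d1_gt0 near1] := cvu.
have /cvgrPdist_lt/(_ _ e2_gt0)/nbhs_normP[d2 /= d2_gt0 near2] := cuv.
pose d := Num.min d1 d2.
have d_gt0 : 0 < d by rewrite lt_min d1_gt0.
have b_gt0 : 0 < 1 + `|u| + `|v| by rewrite -addrA ltr_pwDl // addr_ge0.
(* With this h the whole parallelogram lies in the ball of radius d at a. *)
pose h := d / (1 + `|u| + `|v|).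
have h_gt0 : 0 < h by rewrite divr_gt0.
have close c1 c2 : 0 <= c1 <= h -> 0 <= c2 <= h ->
    `|a - (c2 *: v + (c1 *: u + a))| < d.
  move=> /andP[c1_ge0 c1h] /andP[c2_ge0 c2h].
  rewrite addrA opprD addrCA subrr addr0 normrN.
  apply: le_lt_trans (ler_normD _ _) _; rewrite !normrZ !ger0_norm //.
  apply: (@le_lt_trans _ _ (h * (`|u| + `|v|))).
    by rewrite mulrDr addrC lerD // ler_wpM2r.
  by rewrite /h mulrAC ltr_pdivrMr // ltr_pM2l // -addrA ltrDr.
have [c1 [c2 [c1h c2h E1]]] := second_difference a h_gt0 du dvu.
have [k1 [k2 [k1h k2h E2]]] := second_difference a h_gt0 dv duv.
have E : 'D_v ('D_u f) (c2 *: v + (c1 *: u + a)) =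
         'D_u ('D_v f) (k2 *: u + (k1 *: v + a)).
  have h_neq0 : h != 0 by rewrite gt_eqF.
  suff : h * (h * 'D_v ('D_u f) (c2 *: v + (c1 *: u + a))) =
      h * (h * 'D_u ('D_v f) (k2 *: u + (k1 *: v + a))).
    by move/(mulfI h_neq0)/(mulfI h_neq0).
  have swap (p q r s : R) : p - q - (r - s) = p - r - (q - s) by ring.
  have comm : h *: u + (h *: v + a) = h *: v + (h *: u + a) by exact: addrCA.
  rewrite comm in E2; apply: etrans (esym E1) (etrans _ E2).
  exact: swap.
have := near1 _ (lt_le_trans (close _ _ c1h c2h) _).
rewrite ge_min lexx => /(_ isT) /=.
have lt2 : `|a - (k2 *: u + (k1 *: v + a))| < d.
  by rewrite addrCA; exact: close.
have := near2 _ (lt_le_trans lt2 _); rewrite ge_min lexx orbT => /(_ isT) /=.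
rewrite -E => lt_u lt_v.
apply: le_trans (ler_distD ('D_v ('D_u f) (c2 *: v + (c1 *: u + a))) _ _) _.
rewrite [e]splitr; apply: lerD; first exact: ltW lt_v.
by rewrite distrC; apply: ltW lt_u.
Qed.

Lemma cont_diff_continuous (R : realType) d k (f : 'cV[R]_d -> R) :
  cont_diff k f -> continuous f.
Proof. by case: k => // k [df _] x; apply: differentiable_continuous. Qed.

Lemma hess_sym (R : realType) d k (f : 'cV[R]_d -> R) (x : 'cV[R]_d) :
  cont_diff k.+2 f -> (hess f x)^T = hess f x.
Proof.
move=> [df d2f]; apply/matrixP => i j; rewrite !mxE.
have [dfi ci] := d2f i; have [dfj cj] := d2f j.
have derv (g : 'cV[R]_d -> R) (v : 'cV[R]_d) :
    (forall y, differentiable g y) -> forall y, derivable g y v.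
  by move=> dg y; exact: diff_derivable.
exact: (@mixed_derivatives_eq R _ f x (delta_mx j 0) (delta_mx i 0)
  (derv _ _ df) (derv _ _ df) (derv _ _ dfj) (derv _ _ dfi)
  (cont_diff_continuous (cj i) (x := x))
  (cont_diff_continuous (ci j) (x := x))).
Qed.

(** * Gradient and Hessian of the penalized objective *)

Lemma blk_linear (R : realType) n m (i : 'I_n) (h : R) (v x : 'cV[R]_(n * m)) :
  blk i (h *: v + x) = h *: blk i v + blk i x.
Proof. by apply/colP => j; rewrite !mxE. Qed.

Lemma blk_delta (R : realType) n m (i k : 'I_n) (j : 'I_m) :
  blk k (delta_mx (mxtens_index (i, j)) 0 : 'cV[R]_(n * m)) =
  (if k == i then delta_mx j 0 else 0).
Proof.
apply/colP => l; rewrite !mxE andbT (can_eq (@mxtens_indexK _ _)) xpair_eqE.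
by case: eqP => _; rewrite ?mxE ?eqxx ?andbT.
Qed.

(** Extracting a block is linear, so the two difference quotients are equal. *)
Lemma is_derive_blk (R : realType) n m (g : 'cV[R]_m -> R) (i : 'I_n)
    (x v : 'cV[R]_(n * m)) : derivable g (blk i x) (blk i v) ->
  is_derive x v (fun y => g (blk i y)) ('D_(blk i v) g (blk i x)).
Proof.
have quotE : (fun k => k^-1 *: (((fun y => g (blk i y)) \o shift x) (k *: v)
      - g (blk i x))) =
    (fun k => k^-1 *: ((g \o shift (blk i x)) (k *: blk i v) - g (blk i x))).
  by apply/funext => k /=; rewrite blk_linear.
by move=> dg; split; rewrite /derivable /derive quotE.
Qed.

(** A function that is a polynomial of degree at most 2 along the line has its
    linear coefficient as derivative; this covers the linear and the quadratic
    maps below without a product rule for matrices. *)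
Lemma is_derive_quadratic_along (R : realType) (V : normedModType R) (g : V -> R)
    (x v : V) (a b : R) :
  (forall h, g (h *: v + x) - g x = h * (a + h * b)) -> is_derive x v g a.
Proof.
move=> gE.
have lim_ab : (a + h * b : R) @[h --> 0^'] --> a.
  have : (a + h * b : R) @[h --> 0^'] --> a + 0 * b.
    apply: cvgD; first exact: cvg_cst.
    by apply: cvgMr_tmp; exact: nbhs_dnbhs.
  by rewrite mul0r addr0.
have lim_a : h^-1 *: ((g \o shift x) (h *: v) - g x) @[h --> 0^'] --> a.
  apply: cvg_trans lim_ab; apply: near_eq_cvg; near=> h.
  rewrite /= gE /GRing.scale /= mulrA mulVf ?mul1r //.
  by near: h; exact: nbhs_dnbhs_neq.
split; first by apply/cvg_ex; exists a.
by apply/cvg_lim.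
Unshelve. all: by end_near. Qed.

Lemma is_derive_coord_mulmx (R : realType) d (M : 'M[R]_d) (p : 'I_d)
    (x v : 'cV[R]_d) :
  is_derive x v (fun y => (M *m y) p 0) ((M *m v) p 0).
Proof.
apply: (@is_derive_quadratic_along _ _ _ _ _ _ 0) => h.
by rewrite mulmxDr -scalemxAr !mxE mulr0 addr0 addrK.
Qed.

Lemma is_derive_quad_form (R : realType) d (M : 'M[R]_d) (x v : 'cV[R]_d) :
  M^T = M ->
  is_derive x v (fun y => (y^T *m M *m y) 0 0) (2 * dotv v (M *m x)).
Proof.
move=> Msym; apply: (@is_derive_quadratic_along _ _ _ _ _ _ (dotv v (M *m v))) => h.
rewrite -!mulmxA -!dotvE mulmxDr -scalemxAr !(dotvDl, dotvDr, dotvZl, dotvZr).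
have -> : dotv x (M *m v) = dotv v (M *m x) by rewrite dotv_adj Msym dotvC.
by ring.
Qed.

Lemma dotv_delta (R : realType) d (p : 'I_d) (x : 'cV[R]_d) :
  dotv (delta_mx p 0) x = x p 0.
Proof.
rewrite /dotv (bigD1 p) //= mxE !eqxx mul1r big1 ?addr0 // => q /negbTE qp.
by rewrite mxE qp mul0r.
Qed.

Lemma WD_sym (R : realType) n m (D : 'M[R]_n) :
  D^T = D -> (1%:M - WD m D)^T = 1%:M - WD m D.
Proof. by move=> Dsym; rewrite linearB /= trmx1 /WD trmx_tens Dsym trmx1. Qed.

Lemma partial_Fsum (R : realType) n m (f : 'I_n -> 'cV[R]_m -> R) j :
  (forall i x, differentiable (f i) x) ->
  partial j (Fsum f) = Fsum (fun i => partial j (f i)).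
Proof.
move=> df; apply/funext => x; rewrite /partial.
have -> : Fsum f = \sum_(i < n) f i by apply/funext => y; rewrite fct_sumE.
by rewrite derive_sum // => i; exact: diff_derivable.
Qed.

Lemma hess_Fsum (R : realType) n m k (f : 'I_n -> 'cV[R]_m -> R) x :
  (forall i, cont_diff k.+2 (f i)) ->
  hess (Fsum f) x = \sum_(i < n) hess (f i) x.
Proof.
move=> fC; apply/matrixP => a b; rewrite mxE summxE partial_Fsum; last first.
  by move=> i; case: (fC i).
rewrite partial_Fsum => [|i]; last by have [_ /(_ a) []] := fC i.
by rewrite /Fsum; apply: eq_bigr => i _; rewrite mxE.
Qed.

Lemma is_derive_Fc (R : realType) n m (f : 'I_n -> 'cV[R]_m -> R)
    (x v : 'cV[R]_(n * m)) : (forall i x, differentiable (f i) x) ->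
  is_derive x v (Fc f) (\sum_(k < n) 'D_(blk k v) (f k) (blk k x)).
Proof.
move=> df.
have -> : Fc f = \sum_(k < n) (fun y => f k (blk k y)).
  by apply/funext => y; rewrite fct_sumE.
apply: is_derive_sum => k; apply: is_derive_blk; exact: diff_derivable.
Qed.

Lemma partial_Fc (R : realType) n m (f : 'I_n -> 'cV[R]_m -> R) i j
    (x : 'cV[R]_(n * m)) : (forall i x, differentiable (f i) x) ->
  partial (mxtens_index (i, j)) (Fc f) x = partial j (f i) (blk i x).
Proof.
move=> df; rewrite /partial (@derive_val _ _ _ _ _ _ _ (is_derive_Fc _ _ df)).
rewrite (bigD1 i) //= blk_delta eqxx big1 ?addr0 // => k /negbTE ki.
by rewrite blk_delta ki derive0.
Qed.

Lemma partial_Lalpha (R : realType) n m (D : 'M[R]_n)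
    (f : 'I_n -> 'cV[R]_m -> R) (alpha : R) p (x : 'cV[R]_(n * m)) :
  D^T = D -> alpha != 0 -> (forall i x, differentiable (f i) x) ->
  partial p (Lalpha D f alpha) x =
  partial p (Fc f) x + alpha^-1 * ((1%:M - WD m D) *m x) p 0.
Proof.
move=> Dsym a0 df.
have dq := is_deriveZ (2 * alpha)^-1
  (is_derive_quad_form x (delta_mx p 0) (WD_sym m Dsym)).
have dL := is_deriveD (is_derive_Fc x (delta_mx p 0) df) dq.
rewrite /partial (@derive_val _ _ _ _ _ _ _ dL).
rewrite (@derive_val _ _ _ _ _ _ _ (is_derive_Fc _ _ df)); congr (_ + _).
rewrite dotv_delta /GRing.scale /=; set c := ((1%:M - _) *m x) p 0.
by field.
Qed.

(** Each f_i depends on its own block only, so that distinct blocks interact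
    through the penalty alone; the penalty is quadratic, so that its Hessian does
    not depend on x. *)
Lemma hess_Lalpha (R : realType) n m k0 (D : 'M[R]_n)
    (f : 'I_n -> 'cV[R]_m -> R) (alpha : R) (x : 'cV[R]_(n * m)) i j k l :
  D^T = D -> alpha != 0 -> (forall i, cont_diff k0.+2 (f i)) ->
  hess (Lalpha D f alpha) x (mxtens_index (i, j)) (mxtens_index (k, l)) =
  (i == k)%:R * hess (f i) (blk i x) j l +
  alpha^-1 * (1%:M - WD m D) (mxtens_index (i, j)) (mxtens_index (k, l)).
Proof.
move=> Dsym a0 fC; have df i' y : differentiable (f i') y by case: (fC i').
rewrite mxE; set p := mxtens_index (i, j); set q := mxtens_index (k, l).
have -> : partial p (Lalpha D f alpha) =
    (fun y => partial j (f i) (blk i y)) +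
    alpha^-1 \*: (fun y => ((1%:M - WD m D) *m y) p 0).
  by apply/funext => y; rewrite partial_Lalpha // partial_Fc.
have dpart : derivable (partial j (f i)) (blk i x) (blk i (delta_mx q 0)).
  by apply: diff_derivable; have [_ /(_ j) []] := fC i.
have dH := is_deriveD (is_derive_blk dpart)
  (is_deriveZ alpha^-1 (is_derive_coord_mulmx (1%:M - WD m D) p x (delta_mx q 0))).
rewrite /partial (@derive_val _ _ _ _ _ _ _ dH); congr (_ + _); last first.
  by rewrite -colE mxE.
rewrite blk_delta; case: eqP => _; last by rewrite derive0 mul0r.
by rewrite mul1r mxE.
Qed.

Lemma hess_Lalpha_sym (R : realType) n m k0 (D : 'M[R]_n)
    (f : 'I_n -> 'cV[R]_m -> R) (alpha : R) (x : 'cV[R]_(n * m)) :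
  D^T = D -> alpha != 0 -> (forall i, cont_diff k0.+2 (f i)) ->
  (hess (Lalpha D f alpha) x)^T = hess (Lalpha D f alpha) x.
Proof.
move=> Dsym a0 fC; apply/matrixP => p q; rewrite mxE.
case: (mxtens_indexP p) => i j; case: (mxtens_indexP q) => k l.
have Wsym := congr1 (fun M : 'M[R]_(n * m) =>
  M (mxtens_index (i, j)) (mxtens_index (k, l))) (WD_sym m Dsym).
rewrite [X in X = _]mxE in Wsym.
rewrite !(hess_Lalpha _ _ _ _ _ Dsym a0 fC) Wsym eq_sym; congr (_ + _).
case: eqP => [->|]; last by rewrite !mul0r.
by rewrite !mul1r -[in RHS](hess_sym _ (fC k)) [in RHS]mxE.
Qed.

Lemma sum_mxtens_index (R : nmodType) n m (G : 'I_(n * m) -> R) :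
  \sum_q G q = \sum_(k < n) \sum_(l < m) G (mxtens_index (k, l)).
Proof.
rewrite pair_big (reindex (@mxtens_index n m)) /=.
  by apply: eq_bigr => -[k l].
by exists (@mxtens_unindex n m) => q _; rewrite (mxtens_indexK, mxtens_unindexK).
Qed.

Lemma ones_tensE (R : realType) n m (u : 'cV[R]_m) (i : 'I_n) (j : 'I_m) :
  (ones R n *t u : 'cV[R]_(n * m)) (mxtens_index (i, j)) 0 = u j 0.
Proof.
have := tensmxE (ones R n) u i j 0 0; rewrite [X in _ = X * _]mxE mul1r => <-.
by congr (fun_of_matrix _ _ _); apply: val_inj.
Qed.

(** A consensual direction 1 (x) u does not see the penalty: D is row stochastic,
    so W_D fixes this direction. *)
Lemma quad_form_hess_Lalpha (R : realType) n m k0 (D : 'M[R]_n)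
    (f : 'I_n -> 'cV[R]_m -> R) (alpha : R) (x : 'cV[R]_(n * m)) (u : 'cV[R]_m) :
  D^T = D -> (forall i, \sum_j D i j = 1) -> alpha != 0 ->
  (forall i, cont_diff k0.+2 (f i)) ->
  dotv (ones R n *t u) (hess (Lalpha D f alpha) x *m (ones R n *t u)) =
  \sum_(i < n) dotv u (hess (f i) (blk i x) *m u).
Proof.
move=> Dsym D1 a0 fC; set v : 'cV[R]_(n * m) := ones R n *t u.
have vE i j : v (mxtens_index (i, j)) 0 = u j 0 := ones_tensE u i j.
have Wv : (1%:M - WD m D) *m v = 0.
  have D1v : D *m ones R n = ones R n.
    apply/colP => i; rewrite mxE [RHS]mxE -[RHS](D1 i).
    by apply: eq_bigr => j _; rewrite mxE mulr1.
  have WDv : WD m D *m v = v.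
    by apply: etrans (tensmx_mul D 1%:M (ones R n) u) _; rewrite mul1mx D1v.
  by rewrite mulmxBl mul1mx WDv subrr.
have HvE i j : (hess (Lalpha D f alpha) x *m v) (mxtens_index (i, j)) 0 =
    (hess (f i) (blk i x) *m u) j 0.
  have := congr1 (fun w : 'cV[R]_(n * m) => w (mxtens_index (i, j)) 0) Wv.
  rewrite [X in X = _]mxE [X in _ = X]mxE => Wv0.
  (* The zero added on the right is the contribution of alpha^-1 (I - W_D),
     so that both sides can be compared term by term. *)
  rewrite mxE -[RHS]addr0 -[X in _ + X](mulr0 alpha^-1) -[X in _ * X]Wv0 mxE.
  rewrite mulr_sumr.
  rewrite !sum_mxtens_index [in RHS](_ : \sum_l _ = \sum_(k < n) \sum_(l < m)
     (i == k)%:R * hess (f i) (blk i x) j l * u l 0); last first.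
    rewrite (bigD1 i) //= [X in _ + X]big1 ?addr0; last first.
      by move=> k ki; rewrite big1 // => l _; rewrite eq_sym (negbTE ki) !mul0r.
    by apply: eq_bigr => l _; rewrite eqxx mul1r.
  rewrite -big_split; apply: eq_bigr => k _; rewrite -big_split.
  apply: eq_bigr => l _ /=.
  by rewrite (hess_Lalpha _ _ _ _ _ Dsym a0 fC) vE mulrDl mulrA.
rewrite /dotv sum_mxtens_index.
by apply: eq_bigr => i _; apply: eq_bigr => j _; rewrite vE HvE.
Qed.

(** * Limits of the iteration *)

(** Extracting a block does not increase the sup norm, which is the norm that
    defines the topology. *)
Lemma blk_continuous (R : realType) n m (i : 'I_n) :
  continuous (@blk R n m i).
Proof.
move=> x; apply/(@cvgrPdist_lt _ _ _ _ (nbhs_filter x)) => e e_gt0.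
apply: (@nbhs_normP R _ x _).2.
exists e => //= y lt.
apply: le_lt_trans lt; rewrite [leLHS]/Num.Def.normr/= mx_normrE.
apply: bigmax_le => // -[j k] _; rewrite [leRHS]/Num.Def.normr/= mx_normrE.
apply: le_trans (le_bigmax _ _ (mxtens_index (i, j), 0)) => /=.
by rewrite !mxE.
Qed.

(** By continuity of the gradients the limit is a fixed point of the iteration,
    and the iteration is gradient descent on L_alpha. *)
Lemma DGD_limit_crit (R : realType) n m k (D : 'M[R]_n)
    (f : 'I_n -> 'cV[R]_m -> R) (alpha : R) (x : nat -> 'cV[R]_(n * m)) xinf :
  D^T = D -> 0 < alpha -> (forall i, cont_diff k.+2 (f i)) ->
  DGD D f alpha x -> x nu @[nu --> \oo] --> xinf ->
  crit (Lalpha D f alpha) xinf.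
Proof.
move=> Dsym a_gt0 fC x_dgd x_lim.
have df i y : differentiable (f i) y by case: (fC i).
apply/colP => p; rewrite !mxE partial_Lalpha ?gt_eqF //.
have coordL (q : 'I_(n * m)) : x nu q 0 @[nu --> \oo] --> xinf q 0.
  exact: (continuous_cvg _ (@coord_continuous _ _ _ q 0 xinf) x_lim).
have gradL : partial p (Fc f) (x nu) @[nu --> \oo] --> partial p (Fc f) xinf.
  case: (mxtens_indexP p) => i j.
  under eq_fun do rewrite partial_Fc //; rewrite partial_Fc //.
  have pc : {for blk i xinf, continuous (partial j (f i))}.
    by have [_ /(_ j)[/(_ (blk i xinf)) /differentiable_continuous]] := fC i.
  apply: (continuous_cvg _ pc).
  exact: (continuous_cvg _ (@blk_continuous _ _ _ i xinf) x_lim).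
have WL : (WD m D *m x nu) p 0 @[nu --> \oo] --> (WD m D *m xinf) p 0.
  under eq_fun do rewrite mxE; rewrite mxE.
  apply: cvg_big => [|q _]; first exact: add_continuous.
  by apply: cvgMl_tmp; exact: coordL.
have stepL : x nu.+1 p 0 @[nu --> \oo] -->
    (WD m D *m xinf) p 0 - alpha * partial p (Fc f) xinf.
  have stepE nu : x nu.+1 p 0 =
      (WD m D *m x nu) p 0 - alpha * partial p (Fc f) (x nu).
    by rewrite x_dgd mxE [X in _ + X]mxE [X in _ - X]mxE [X in _ * X]mxE.
  under eq_fun do rewrite stepE.
  by apply: cvgB => //; apply: cvgMl_tmp.
have : x nu.+1 p 0 @[nu --> \oo] --> xinf p 0.
  by have := coordL p; rewrite -(cvg_shiftS (fun nu => x nu p 0)).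
move/(cvg_unique (@norm_hausdorff _ _) stepL) => E.
rewrite mulmxBl mul1mx !mxE in E *.
rewrite -E; field; exact: lt0r_neq0.
Qed.

(** * Negative curvature in a consensual direction *)

Lemma dist_proj (R : realType) d (A : set 'cV[R]_d) z w :
  proj_set A z w -> enorm (z - w) <= dist z A.
Proof.
move=> [Aw wmin]; apply: lb_le_inf; first by exists (enorm (z - w)), w.
by move=> _ [y Ay <-]; exact: wmin.
Qed.

Lemma enorm_blk_le (R : realType) n m (i : 'I_n) (x : 'cV[R]_(n * m)) :
  enorm (blk i x) <= enorm x.
Proof.
apply: ler_wsqrtr; rewrite [leRHS]/dotv sum_mxtens_index (bigD1 i) //=.
have -> : dotv (blk i x) (blk i x) =
    \sum_(l < m) x (mxtens_index (i, l)) 0 * x (mxtens_index (i, l)) 0.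
  by apply: eq_bigr => l _; rewrite !mxE.
rewrite lerDl sumr_ge0 // => k _; rewrite sumr_ge0 // => l _.
by rewrite -expr2 sqr_ge0.
Qed.

Lemma blk_ones (R : realType) n m (i : 'I_n) (x : 'cV[R]_(n * m)) (y : 'cV[R]_m) :
  blk i (x - ones R n *t y) = blk i x - y.
Proof.
apply/colP => j; rewrite mxE [LHS]mxE [RHS]mxE [in RHS]mxE; congr (_ + _).
by rewrite mxE [RHS]mxE; congr (- _); exact: ones_tensE.
Qed.

(** A vector u that is not zero is needed: in dimension 0 every constant is a
    Lipschitz constant. *)
Lemma hess_lipschitz_ge0 (R : realType) d (f : 'cV[R]_d -> R) L (u : 'cV[R]_d) :
  u != 0 -> hess_lipschitz L f -> 0 <= L.
Proof.
move=> u0 /(_ u 0); rewrite subr0 => lip.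
have u_gt0 : 0 < enorm u by rewrite sqrtr_gt0 lt_def dotv_ge0 dotv_eq0 u0.
by rewrite -(pmulr_lge0 _ u_gt0); apply: le_trans lip; exact: spectral_norm_ge0.
Qed.

Lemma quad_form_hess_perturb (R : realType) d (f : 'cV[R]_d -> R) L
    (u y z : 'cV[R]_d) : hess_lipschitz L f ->
  dotv u (hess f y *m u) <=
  dotv u (hess f z *m u) + L * enorm (y - z) * dotv u u.
Proof.
move=> lip; rewrite -lerBlDl.
have <- : dotv u ((hess f y - hess f z) *m u) =
    dotv u (hess f y *m u) - dotv u (hess f z *m u).
  by rewrite mulmxBl -scaleN1r dotvDr dotvZr mulN1r.
apply: le_trans (quad_form_le_spectral_norm _ _) _.
by apply: ler_wpM2r (lip y z); exact: dotv_ge0.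
Qed.

(** The direction u is an eigenvector of the Hessian of F at theta for an
    eigenvalue l below minus the total error err of replacing each block of x by
    xbar and then xbar by theta. The two closeness hypotheses make each half of
    this error less than delta / 2, and lambda_min is at most -delta; since the
    inequality err < delta is strict, an eigenvalue close enough to the infimum
    lambda_min suffices. *)
Lemma consensus_negative_curvature (R : realType) n m k
    (f : 'I_n -> 'cV[R]_m -> R)
    (L2 : 'I_n -> R) (x : 'cV[R]_(n * m)) (xbar theta : 'cV[R]_m) (delta : R) :
  (forall i, cont_diff k.+2 (f i)) ->
  (forall i, hess_lipschitz (L2 i) (f i)) ->
  strict_saddle (Fsum f) theta ->
  delta <= - lambda_min (hess (Fsum f) theta) ->
  enorm (xbar - theta) < delta / (2 * \sum_(i < n) L2 i) ->
  enorm (x - ones R n *t xbar) < delta / (2 * n%:R * vmax L2) ->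
  exists u : 'cV[R]_m, \sum_(i < n) dotv u (hess (f i) (blk i x) *m u) < 0.
Proof.
move=> fC lip [_ [l0 eig0 _]] delta_le near_theta near_consensus.
have [w0 _ w0_neq0] := eigenvalueP eig0.
have L2_ge0 i : 0 <= L2 i.
  by apply: (@hess_lipschitz_ge0 _ _ (f i) _ w0^T) => //; rewrite trmx_eq0.
(* If c = 0 the quotient is 0, so that a >= 0 excludes this case. *)
have bound (a b c : R) : 0 <= a -> 0 <= c -> a < b / (2 * c) -> c * a < b / 2.
  move=> a_ge0 c_ge0 ab; have c_gt0 : 0 < c.
    rewrite lt_def c_ge0 andbT; apply/eqP => c0.
    by move: ab; rewrite c0 mulr0 invr0 mulr0 ltNge a_ge0.
  by rewrite mulrC -ltr_pdivlMr // -mulrA -invfM.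
have sumL2_ge0 : 0 <= \sum_(i < n) L2 i by exact: sumr_ge0.
have vmax_ge0 : 0 <= vmax L2 by exact: bigmax_ge_id.
have lt_theta := bound _ _ _ (sqrtr_ge0 _) sumL2_ge0 near_theta.
have lt_consensus : (n%:R * vmax L2) * enorm (x - ones R n *t xbar) < delta / 2.
  by apply: bound; rewrite ?sqrtr_ge0 ?mulr_ge0 ?ler0n // mulrA.
pose err := \sum_(i < n) L2 i * enorm (blk i x - xbar) +
            \sum_(i < n) L2 i * enorm (xbar - theta).
have err_lt : err < delta.
  rewrite [delta]splitr; apply: ltrD; last by rewrite -mulr_suml.
  apply: le_lt_trans lt_consensus.
  (* Each block of the consensus error is bounded by the whole error, whence the
     factor n. *)
  rewrite -mulrA mulr_natl -[X in _ *+ X]card_ord -sumr_const.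
  apply: ler_sum => i _.
  apply: ler_pM (L2_ge0 i) (sqrtr_ge0 _) _ _; first exact: le_bigmax.
  by rewrite -blk_ones enorm_blk_le.
have [l eig l_lt] : exists2 l, eigenvalue (hess (Fsum f) theta) l & l < - err.
  apply: inf_lt; first by exists l0.
  by rewrite -/(lambda_min _) ltrNr; apply: lt_le_trans delta_le.
have [w wl w_neq0] := eigenvalueP eig.
have ww_gt0 : 0 < dotv w^T w^T by rewrite lt_def dotv_ge0 dotv_eq0 trmx_eq0 w_neq0.
exists w^T.
have eigE : \sum_(i < n) dotv w^T (hess (f i) theta *m w^T) = l * dotv w^T w^T.
  rewrite -dotv_sumr -mulmx_suml -(hess_Fsum theta fC) dotvE trmxK mulmxA wl.
  by rewrite -scalemxAl mxE dotvE trmxK.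
apply: (@le_lt_trans _ _ ((l + err) * dotv w^T w^T)); last first.
  by rewrite pmulr_llt0 // -ltrBrDr sub0r.
rewrite mulrDl -eigE /err -big_split mulr_suml -big_split /=.
apply: ler_sum => i _; rewrite mulrDl.
apply: le_trans (quad_form_hess_perturb _ _ xbar (lip i)) _.
rewrite [leRHS]addrCA [leLHS]addrC lerD2l.
exact: quad_form_hess_perturb.
Qed.

Theorem proposition3p10 (R : realType) (n m r : nat)
  (f : 'I_n -> 'cV[R]_m -> R) (L L2 : 'I_n -> R)
  (e : rel 'I_n) (D : 'M[R]_n)
  (rho eps0 delta0 : R)
  (X : 'I_n -> set 'cV[R]_m)
  (alpha : R) (x : nat -> 'cV[R]_(n * m))
  (Y : set 'cV[R]_(n * m))
  (xinf : 'cV[R]_(n * m)) (delta : R)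
  (r_ge1 : (1 <= r)%N)
  (f_coercive : forall i, coercive (f i))
  (f_smooth : forall i, cont_diff r.+1 (f i))
  (f_grad_lip : forall i, grad_lipschitz (L i) (f i))
  (f_hess_lip : forall i, hess_lipschitz (L2 i) (f i))
  (eps0_gt0 : 0 < eps0) (eps0_lt_rho : eps0 < rho) (delta0_gt0 : 0 < delta0)
  (f_shell : forall i,
     (delta0%:E <=
      ereal_inf [set (dotv (grad (f i) theta) ((enorm theta)^-1 *: theta))%:E
                | theta in shell rho eps0])%E)
  (graph_connected : connected_graph e)
  (D_weights : weight_matrix e D)
  (X_ball : forall i, X i `<=` eball rho)
  (X_compact : forall i, compact (X i))
  (X_pos : forall i, (0 < lebesgue_outer (X i))%E)
  (alpha_gt0 : 0 < alpha) (alpha_le : alpha <= alpha_max D L)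
  (x_init : forall i, X i (blk i (x 0%N)))
  (x_dgd : DGD D f alpha x)
  (Y_compact : compact Y)
  (Y_dgd : forall (a : R) (y : nat -> 'cV[R]_(n * m)),
     0 < a -> a <= alpha_max D L -> DGD D f a y ->
     (forall i, X i (blk i (y 0%N))) -> forall nu, Y (y nu))
  (x_lim : x nu @[nu --> \oo] --> xinf)
  (delta_le : forall theta,
     strict_saddle (Fsum f) theta ->
     [set (ones_kron R n m)^T *m y | y in Y] theta ->
     delta <= - lambda_min (hess (Fsum f) theta))
  (cond_i : dist (bmean xinf) (crit (Fsum f)) < delta / (2 * \sum_(i < n) L2 i))
  (cond_ii : enorm (xinf - ones R n *t bmean xinf)
             < delta / (2 * n%:R * vmax L2))
  (* The last conjunct holds of itself when theta lies in the image of Y; it is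
     needed because nothing forces theta to lie there, and delta_le alone would
     then leave delta unbounded. *)
  (cond_iii : exists theta,
     [/\ proj_set (crit (Fsum f)) (bmean xinf) theta,
         strict_saddle (Fsum f) theta &
         delta <= - lambda_min (hess (Fsum f) theta)]) :
  strict_saddle (Lalpha D f alpha) xinf.
Proof.
case: r r_ge1 f_smooth => // k _ fC.
have [_ Dsym [D1 _] _ _] := D_weights.
have a0 : alpha != 0 by rewrite gt_eqF.
split; first exact: DGD_limit_crit Dsym alpha_gt0 fC x_dgd x_lim.
have [theta [theta_proj theta_saddle delta_theta]] := cond_iii.
have near_theta := le_lt_trans (dist_proj theta_proj) cond_i.
have [u u_neg] := consensus_negative_curvature fC f_hess_lip theta_saddle
  delta_theta near_theta cond_ii.
apply: (neg_quad_form_eigenvalue (u := ones R n *t u)).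
  exact: hess_Lalpha_sym Dsym a0 fC.
by rewrite (quad_form_hess_Lalpha _ _ Dsym D1 a0 fC).
Qed.
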